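(* Fix an integer $d \ge 3$. There is a constant $C>0$ (depending only on $d$) and a constant $c$ (depending only on $d$ and $C$) such that the following holds. Consider a hash table of $m = Cn$ cells, initially empty, with all wear counts $0$, into which $n$ distinct items are inserted, one after another and with no deletions, using the wear-minimizing cuckoo hashing algorithm with $d$ choices described in the context. Then with high probability (probability tending to $1$ as $n\to\infty$, over the random choice of the hash locations), after all $n$ insertions every cell of the table has wear count at most $\log_2\log_2 n + c$. This holds regardless of how ties are broken.
   Context: Each item $x$ has associated to it $d$ cells of the table, $h_1(x),\dots,h_d(x)$, where the hash functions $h_1,\dots,h_d$ are modeled as fully random: the $d$-tuples of cells assigned to distinct items are independent and uniformly random. Each cell stores at most one item and a wear count, which is the number of times a value has been written into that cell; every write of an item into a cell increases that cell's wear count by one. Wear-minimizing cuckoo hashing with $d$ choices: to insert an item $x$, if one of its $d$ cells is empty, $x$ is written into one of its empty cells (chosen at random). Otherwise $x$ is written into a cell of minimum wear count among its $d$ cells, displacing the item $y$ previously stored there. The displaced item $y$ is then written into a cell of minimum wear count among all $d$ of its cells (including the cell it was just displaced from, whose wear count has just been increased by the write of $x$), with ties broken arbitrarily, displacing any item stored there; the displaced item is treated in the same way, and so on, until an item is written into an empty cell. (Two items may repeatedly displace each other from the same cell; each such write counts toward that cell's wear.) *)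

(* Defs.v *)
From HB Require Import structures.
From mathcomp Require Import all_boot all_order all_algebra.
From mathcomp Require Import boolp classical_sets reals topology normedtype.
From mathcomp Require Import sequences exp.

Set Implicit Arguments.
Unset Strict Implicit.
Unset Printing Implicit Defensive.

Import Order.TTheory GRing.Theory Num.Theory.
Import numFieldNormedType.Exports.

Local Open Scope ring_scope.

(* Items are 'I_n, inserted in the order 0, 1, ..., n-1; cells are 'I_m.      *)

(* The d locations of an item form an arbitrary tuple, so they may coincide.  *)
Definition hashing (d m n : nat) := {ffun 'I_n -> d.-tuple 'I_m}.

(* One transition between states is one write. [begun] counts the items whose *)
(* insertion has started; [hand] is the item displaced by the latest write,   *)
(* if any, which must be rewritten before the next item is inserted.          *)
Record state (m n : nat) := State {
  content : {ffun 'I_m -> option 'I_n};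
  wear : {ffun 'I_m -> nat};
  begun : nat;
  hand : option 'I_n
}.

Definition init_state (m n : nat) : state m n :=
  State [ffun=> None] [ffun=> 0%N] 0 None.

Definition write (m n : nat) (s : state m n) (x : 'I_n) (v : 'I_m) (b : nat) :
    state m n :=
  State [ffun u => if u == v then Some x else content s u]
        [ffun u => (wear s u + (u == v))%N]
        b
        (content s v).

Definition min_wear_cells (d m n : nat) (h : hashing d m n) (s : state m n)
    (x : 'I_n) : {set 'I_m} :=
  [set v in h x | [forall u in h x, (wear s v <= wear s u)%N]].

Definition empty_cells (d m n : nat) (h : hashing d m n) (s : state m n)
    (x : 'I_n) : {set 'I_m} :=
  [set v in h x | content s v == None].

Definition insertion_cells (d m n : nat) (h : hashing d m n) (s : state m n)
    (x : 'I_n) : {set 'I_m} :=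
  if empty_cells h s x != finset.set0 then empty_cells h s x
  else min_wear_cells h s x.

(* Every admissible choice of cell is a possible step, so the relation covers *)
(* all ways of breaking ties and of choosing among empty cells.               *)
Variant step (d m n : nat) (h : hashing d m n) (s : state m n) :
    state m n -> Prop :=
| StepInsert (x : 'I_n) (v : 'I_m) of
    hand s = None & nat_of_ord x = begun s & v \in insertion_cells h s x :
    step h s (write s x v (begun s).+1)
| StepDisplaced (y : 'I_n) (v : 'I_m) of
    hand s = Some y & v \in min_wear_cells h s y :
    step h s (write s y v (begun s)).

Definition finished (m n : nat) (s : state m n) : bool :=
  (hand s == None) && (begun s == n).

(* A maximal run: an infinite sequence of writes if some insertion never      *)
(* ends, and otherwise stationary once all n insertions are complete.         *)
Definition execution (d m n : nat) (h : hashing d m n)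
    (sigma : nat -> state m n) : Prop :=
  sigma 0%N = init_state m n /\
  forall t : nat, if finished (sigma t) then sigma t.+1 = sigma t
                  else step h (sigma t) (sigma t.+1).

Definition max_wear_le (R : realType) (d m n : nat) (h : hashing d m n)
    (b : R) : Prop :=
  forall sigma : nat -> state m n, execution h sigma ->
  exists T : nat, finished (sigma T) /\
    forall v : 'I_m, (wear (sigma T) v)%:R <= b.

Definition log2 (R : realType) (x : R) : R := ln x / ln 2.

Definition uniform_proba (R : realType) (Omega : finType) (E : Omega -> Prop) :
    R :=
  #|[set w : Omega | `[< E w >]]%SET|%:R / #|Omega|%:R.

(* Main.v *)
(* Write h(S) for the set of cells of a set S of items.  When C is large, a
   first-moment bound shows that with probability 1 - O(1/n) every S satisfies
   |h(S)| >= (d-1)|S| (a component has at most one cycle), and even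
   |h(S)| >= (d-1)|S| + 2 once |S| > 2 log2 n (components are small); the rest is
   deterministic.

   When an item x raises the wear of a cell to k+1, x is stored nowhere, and each
   of its d >= 3 cells has wear at least k and holds an item other than x.
   Following these items back in time gives a tree that branches at least twice
   at every level, in which revisiting an item would close a cycle.  If x lies
   in no tight set, one with |h(T)| = (d-1)|T|, no cycle ever closes.  Otherwise
   take T minimal tight containing x.  If all cells of x held items of T, double
   counting the cells of T would contradict minimality, so some branch leaves T,
   and outside T no second cycle can close.  Either way there are at least 2^k
   items S' with |h(S')| <= (d-1)|S'| + 1, so 2^k <= 2 log2 n + O(1).  Since each
   write increases the total wear, bounded wear also forces termination. *)

Require Import Defs.
From mathcomp Require Import all_boot all_order all_algebra.
From mathcomp Require Import zify.

Set Implicit Arguments.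
Unset Strict Implicit.
Unset Printing Implicit Defensive.

(** * Witness trees *)

Definition cells (d m n : nat) (h : hashing d m n) (S : {set 'I_n}) :
    {set 'I_m} :=
  \bigcup_(x in S) [set v in h x].

Lemma mem_cells d m n (h : hashing d m n) (S : {set 'I_n}) x v :
  x \in S -> v \in h x -> v \in cells h S.
Proof. by move=> xS vx; apply/bigcupP; exists x => //; rewrite inE. Qed.

Lemma cellsU d m n (h : hashing d m n) (S T : {set 'I_n}) :
  cells h (S :|: T) = cells h S :|: cells h T.
Proof. exact: bigcup_setU. Qed.

Lemma cells1 d m n (h : hashing d m n) x :
  cells h [set x] = [set v in h x].
Proof. exact: big_set1. Qed.

Lemma card_disjointU (T : finType) (A B : {set T}) :
  [disjoint A & B] -> #|A :|: B| = #|A| + #|B|.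
Proof. by move=> dAB; apply/eqP; rewrite (leq_card_setU A B). Qed.

Lemma card_cells1 d m n (h : hashing d m n) x : #|cells h [set x]| <= d.
Proof.
by rewrite cells1 cardsE (leq_trans (card_size _)) // size_tuple.
Qed.

(* With [g S := #|cells h S| - d.-1 * #|S|], this says [g A <= g T]. *)
Definition stable d m n (h : hashing d m n) (A : {set 'I_n}) : Prop :=
  forall T : {set 'I_n}, A \subset T ->
    #|cells h A| + d.-1 * #|T| <= #|cells h T| + d.-1 * #|A|.

(** Stability at [z |: A] forces at least [d.-1] new cells, while [z] has at most [d] cells and one
    of them, [w], is already in [cells h A]. Both bounds are therefore attained: [z] shares no cell
    but [w], and [g (z |: A) = g A], so stability passes on. *)
Lemma stableU1 d m n (h : hashing d m n) (A : {set 'I_n}) z w :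
  0 < d -> stable h A -> z \notin A -> w \in h z -> w \in cells h A ->
  [/\ #|cells h (z |: A)| = #|cells h A| + d.-1,
      stable h (z |: A),
      cells h [set z] :&: cells h A = [set w] &
      #|cells h [set z] :\: cells h A| = d.-1].
Proof.
move=> d0 stA zA wz wA.
have cI : 0 < #|cells h [set z] :&: cells h A|.
  by apply/card_gt0P; exists w; rewrite inE wA cells1 inE wz.
have cz := card_cells1 h z.
have cD := cardsID (cells h A) (cells h [set z]).
have cU : #|cells h (z |: A)| = #|cells h A| + #|cells h [set z] :\: cells h A|.
  have := subset_leq_card (subsetIl (cells h [set z]) (cells h A)).
  by rewrite cellsU cardsU cardsD; lia.
have cA1 : #|z |: A| = #|A|.+1 by rewrite cardsU1 zA.
have := stA _ (subsetUr [set z] A); rewrite cU cA1 mulnS => ineq.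
have cDe : #|cells h [set z] :\: cells h A| = d.-1 by lia.
split; last exact: cDe.
- by rewrite cDe.
- move=> T sT; have := stA T (subset_trans (subsetUr _ _) sT).
  by rewrite cU cA1 cDe mulnS; lia.
- apply/esym/eqP; rewrite eqEcard sub1set inE wA cells1 inE wz cards1 -cells1.
  by lia.
Qed.

(** * Invariants of an execution *)

Definition consistent m n (s : state m n) : Prop :=
  [/\ forall u y, content s u = Some y ->
        y < begun s /\ forall u', content s u' = Some y -> u' = u,
      forall y, hand s = Some y ->
        y < begun s /\ forall u, content s u <> Some y &
      forall u, (content s u == None) = (wear s u == 0)].

Lemma consistent_init m n : consistent (init_state m n).
Proof. by split => [u y|//|u]; rewrite /= ?ffunE. Qed.

(** Merges the two kinds of step: under [consistent] an empty cell has wear 0, hence minimum wear,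
    so an insertion also writes into one of the [min_wear_cells]. *)
Lemma stepP d m n (h : hashing d m n) s s' : consistent s -> step h s s' ->
  exists x v b, [/\ s' = write s x v b, v \in min_wear_cells h s x,
    forall u, content s u <> Some x & consistent s'].
Proof.
move=> [cP hP wP] st.
have key x v b : v \in min_wear_cells h s x -> x < b -> begun s <= b ->
    (forall u, content s u <> Some x) -> consistent (write s x v b).
  move=> vx xb sb xs; split => [u y||u] /=.
  - rewrite ffunE; case: (u =P v) => [-> [<-]|uv cu].
      by split => // u' /=; rewrite ffunE; case: eqP => // _ /xs.
    have [yb un] := cP _ _ cu; split; first exact: leq_trans sb.
    move=> u'; rewrite ffunE; case: eqP => [-> [xy]|_]; last exact: un.
    by case: (xs u); rewrite xy.
  - move=> y cv; have [yb un] := cP _ _ cv; split; first exact: leq_trans sb.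
    move=> u; rewrite ffunE; case: (u =P v) => [_ [xy]|uv cu].
      by case: (xs v); rewrite xy.
    exact: uv (un _ cu).
  - by rewrite !ffunE; case: (u =P v) => _; rewrite /= ?addn0 ?addn1 ?wP.
case: st => [x v h0 xb|y v hy] vin.
- have xs u : content s u <> Some x by move=> /cP[]; rewrite xb ltnn.
  have vx : v \in min_wear_cells h s x.
    move: vin; rewrite /insertion_cells; case: ifP => // _.
    rewrite !inE => /andP[-> /=]; rewrite wP => /eqP v0.
    by apply/forallP => u; rewrite v0; apply/implyP.
  by exists x, v, (begun s).+1; split => //; apply: key; rewrite ?xb.
- have [yb ys] := hP _ hy.
  by exists y, v, (begun s); split => //; apply: key.
Qed.

Lemma consistent_execution d m n (h : hashing d m n) sigma t :
  execution h sigma -> consistent (sigma t).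
Proof.
move=> [s0 st]; elim: t => [|t IHt].
  by rewrite s0; apply: consistent_init.
have := st t; case: ifP => _ => [->//|/(stepP IHt)].
by case=> x [v [b []]].
Qed.

(* [t1] is the time of the write that put [z] into [w]: [z] is then stored
   nowhere, so all its cells hold other items. *)
Lemma last_write d m n (h : hashing d m n) sigma t w z :
  execution h sigma -> content (sigma t) w = Some z ->
  exists t1, [/\ w \in h z,
    forall u, u \in h z -> wear (sigma t) w <= (wear (sigma t1) u).+1 &
    forall u, content (sigma t1) u <> Some z].
Proof.
move=> ex; have [s0 st] := ex; elim: t => [|t IHt].
  by rewrite s0 /= ffunE.
have := st t; case: ifP => _ => [->//|/(stepP (consistent_execution t ex))].
case=> x [v [b [-> vx xs _]]]; rewrite /= !ffunE.
case: eqP => [-> [<-]|_ /IHt]; last by rewrite addn0.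
exists t; move: vx; rewrite inE => /andP[vx /forallP vmin]; split => // u ux.
by have := vmin u; rewrite ux /= addn1 ltnS.
Qed.

Lemma content_cells d m n (h : hashing d m n) sigma t w z :
  execution h sigma -> content (sigma t) w = Some z -> w \in h z.
Proof. by move=> ex /(last_write ex)[t1 []]. Qed.

(** * Growth of the witness tree *)

(** Induction on [k]: the item stored in [w] joins [A], and two of its new cells become roots of
    subtrees, the second grown over [A] enlarged by the first. Stability rules out closing a cycle.
    The last clause, that [S] touches [cells h A] at most at its root, is what keeps the two
    subtrees apart. *)
Lemma witness_tree d m n (h : hashing d m n) sigma k t w (A : {set 'I_n}) :
  2 < d -> execution h sigma -> stable h A -> w \in cells h A ->
  (forall z, content (sigma t) w = Some z -> z \notin A) ->
  k <= wear (sigma t) w ->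
  exists S : {set 'I_n}, [/\ [disjoint S & A], 2 ^ k <= #|S|.+1,
    #|cells h (S :|: A)| = #|cells h A| + d.-1 * #|S|, stable h (S :|: A) &
    cells h S :&: cells h A \subset [set w]].
Proof.
move=> d3 ex; elim: k t w A => [|k IHk] t w A stA wA zA wk.
  exists set0; rewrite set0U cards0 muln0 addn0 disjoints_subset sub0set.
  split=> //; rewrite /cells big_set0 set0I; exact: sub0set.
case cw : (content (sigma t) w) => [z|]; last first.
  have [_ _ /(_ w)] := consistent_execution t ex.
  by rewrite cw eqxx => /esym/eqP w0; rewrite w0 in wk.
have {}zA := zA _ cw; have [t1 [wz wt1 zt1]] := last_write ex cw.
have [cA1 stA1 Iw cD] := stableU1 (ltnW (ltnW d3)) stA zA wz wA.
have : 1 < #|cells h [set z] :\: cells h A| by rewrite cD; lia.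
case/card_gt1P => u1 [u2 []]; rewrite cells1 !inE.
move=> /andP[u1A u1z] /andP[u2A u2z] u12.
have outA u y : u \notin cells h A ->
    content (sigma t1) u = Some y -> y \notin z |: A.
  move=> uA cu; rewrite !inE negb_or; apply/andP; split.
    by apply/eqP => yz; apply: (zt1 u); rewrite cu yz.
  by apply: contraNN uA => yA; apply: mem_cells yA (content_cells ex cu).
have inA u : u \in h z -> u \in cells h (z |: A).
  by apply: mem_cells; rewrite !inE eqxx.
have kt u : u \in h z -> k <= wear (sigma t1) u.
  by move=> /wt1 /(leq_trans wk).
have [S1 [dS1 cS1 eS1 stS1 IS1]] :=
  IHk t1 u1 (z |: A) stA1 (inA _ u1z) (fun y => outA u1 y u1A) (kt _ u1z).
(* If the item in [u2] belonged to [S1], then [u2] would be a cell common to [S1] and [z |: A], and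
   only [u1] can be one. *)
have outS1 y : content (sigma t1) u2 = Some y -> y \notin S1 :|: (z |: A).
  move=> cu; rewrite in_setU negb_or (outA u2 y u2A cu) andbT.
  apply/negP => yS1; move/subsetP: IS1 => /(_ u2).
  rewrite in_setI (inA _ u2z) (mem_cells yS1 (content_cells ex cu)) => /(_ isT).
  by rewrite inE eq_sym (negPf u12).
have inA2 : u2 \in cells h (S1 :|: (z |: A)).
  by rewrite cellsU in_setU (inA _ u2z) orbT.
have [S2 [dS2 cS2 eS2 stS2 IS2]] := IHk t1 u2 _ stS1 inA2 outS1 (kt _ u2z).
exists (S2 :|: (S1 :|: [set z])).
have cardS : #|S2 :|: (S1 :|: [set z])| = #|S2| + (#|S1| + 1).
  rewrite !card_disjointU ?cards1 //.
    by apply: disjointWr dS1; rewrite subsetUl.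
  by apply: disjointWr dS2; rewrite setUS ?subsetUl.
rewrite -!setUA; split=> //.
- move: dS1 dS2; rewrite !disjoints_subset !subUset => dS1 dS2.
  rewrite sub1set inE zA andbT; apply/andP; split.
    by apply: subset_trans dS2 _; rewrite setCS setUA subsetUr.
  by apply: subset_trans dS1 _; rewrite setCS subsetUr.
- by rewrite cardS expnS; move: (2 ^ k) cS1 cS2 => p; clear; lia.
- by rewrite eS2 eS1 cA1 cardS !mulnDr muln1; clear; lia.
(* A cell shared with [A] could only be [u2] for [S2] and [u1] for [S1], both outside [cells h A];
   for [z] it is [w]. *)
rewrite !cellsU !setIUl !subUset; apply/and3P; split.
- apply/subsetP => u; rewrite in_setI => /andP[uS uA].
  move/subsetP: IS2 => /(_ u); rewrite in_setI uS !cellsU !in_setU uA !orbT inE.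
  by move=> /(_ isT) /eqP uu; rewrite uu (negPf u2A) in uA.
- apply/subsetP => u; rewrite in_setI => /andP[uS uA].
  move/subsetP: IS1 => /(_ u); rewrite in_setI uS !cellsU !in_setU uA !orbT inE.
  by move=> /(_ isT) /eqP uu; rewrite uu (negPf u1A) in uA.
- by rewrite Iw.
Qed.

(** The tree together with [A] has at least [2 ^ k] items, and it adds exactly [d.-1] cells per
    item, so [g (S :|: A) = g A <= 1], against [big]. The slack of one admits both starting sets
    used below: a single item and a tight set. *)
Lemma large_witness d m n (h : hashing d m n) sigma k k0 t w (A : {set 'I_n}) :
  2 < d -> execution h sigma ->
  (forall S : {set 'I_n}, k0 <= #|S| -> (d.-1 * #|S|).+1 < #|cells h S|) ->
  k0 <= 2 ^ k -> A != set0 -> #|cells h A| <= (d.-1 * #|A|).+1 ->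
  stable h A -> w \in cells h A -> k <= wear (sigma t) w ->
  (forall z, content (sigma t) w = Some z -> z \notin A) -> False.
Proof.
move=> d3 ex big k0k An0 cA stA wA wk zA.
have [S [dS cS eS _ _]] := witness_tree d3 ex stA wA zA wk.
have cSA := card_disjointU dS.
have := big (S :|: A); rewrite eS cSA mulnDr.
rewrite -card_gt0 in An0; move: (2 ^ k) k0k cS cA An0 => p; clear; lia.
Qed.

(** * Minimal tight sets and the wear bound *)

Lemma card_cellsD1 d m n (h : hashing d m n) (T : {set 'I_n}) x : x \in T ->
  #|cells h T| =
    #|cells h (T :\ x)| + #|cells h [set x] :\: cells h (T :\ x)|.
Proof.
move=> xT; rewrite -{1}(setD1K xT) cellsU cardsU cardsD.
by have := subset_leq_card (subsetIl (cells h [set x]) (cells h (T :\ x))); lia.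
Qed.

(* A cell that belongs to one item only is counted twice for that item. *)
Lemma leq_sum_private d m n (h : hashing d m n) (T : {set 'I_n}) :
  (#|cells h T|).*2 <=
  \sum_(x in T) (#|cells h [set x]| + #|cells h [set x] :\: cells h (T :\ x)|).
Proof.
have cardI (A : {set 'I_m}) : #|A| = \sum_u (u \in A : nat).
  by rewrite -sum1_card big_mkcond; apply: eq_bigr => u _; case: ifP.
under eq_bigr => x _ do rewrite !cardI -big_split /=.
rewrite exchange_big /= cardI -mul2n big_distrr /=.
apply: leq_sum => u _; case: (boolP (u \in cells h T)) => [|_]; last by [].
case/bigcupP => x xT; rewrite inE => ux.
rewrite (bigD1 x) //= in_setD cells1 inE ux andbT.
case: (boolP (u \in _)) => [|_]; last by lia.
case/bigcupP => y; rewrite !inE => /andP[yx yT] uy.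
by rewrite (bigD1 y) ?yT //= cells1 inE uy; lia.
Qed.

Lemma wear_bound d m n (h : hashing d m n) sigma k k0 t v :
  2 < d -> execution h sigma ->
  (forall S : {set 'I_n}, d.-1 * #|S| <= #|cells h S|) ->
  (forall S : {set 'I_n}, k0 <= #|S| -> (d.-1 * #|S|).+1 < #|cells h S|) ->
  k0 <= 2 ^ k -> wear (sigma t) v <= k.
Proof.
move=> d3 ex sparse big k0k; rewrite leqNgt; apply/negP => kv.
case cv : (content (sigma t) v) => [x|]; last first.
  have [_ _ /(_ v)] := consistent_execution t ex.
  by rewrite cv eqxx => /esym/eqP v0; rewrite v0 in kv.
have [t0 [vx xt xs]] := last_write ex cv.
have {}xt u : u \in h x -> k <= wear (sigma t0) u.
  by move=> /xt /(leq_trans kv).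
pose tight (T : {set 'I_n}) := (x \in T) && (#|cells h T| == d.-1 * #|T|).
have cx := card_cells1 h x.
have [T0 T0t|ntight] := pickP tight; last first.
  (* Without tight sets every set containing [x] has [g] at least 1, while [g [set x] <= 1]; hence
     [[set x]] is stable. *)
  apply: (large_witness (A := [set x]) d3 ex big k0k _ _ _ _ (xt _ vx)).
  - by rewrite -card_gt0 cards1.
  - by rewrite cards1 muln1 prednK // (ltn_trans _ d3).
  - move=> T; rewrite sub1set => xT; have /= := ntight T.
    rewrite /tight xT cards1 muln1 => /eqP; move: cx d3 (sparse T).
    by move: #|_| #|cells h T| (_ * _) => a b c; clear; lia.
  - by rewrite (mem_cells _ vx) ?inE.
  - by move=> z cz; rewrite inE; apply/eqP => zx; apply: (xs v); rewrite cz zx.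
case: (arg_minnP (fun T : {set 'I_n} => #|T|) T0t) => T /andP[xT /eqP cT] Tmin.
(* If a cell of [x] were outside [cells h (T :\ x)], the item stored there at time [t0] would be
   outside [T], and a tree could grow over [T], which is stable because [g T = 0] is minimal. *)
have xpriv : cells h [set x] :\: cells h (T :\ x) = set0.
  apply/eqP; rewrite setD_eq0 cells1; apply/subsetP => u; rewrite inE => ux.
  apply: contraT => uT; exfalso.
  apply: (large_witness (A := T) d3 ex big k0k _ _ _ _ (xt _ ux)).
  - by apply/set0Pn; exists x.
  - by rewrite cT.
  - by move=> U _; rewrite cT addnC leq_add2r sparse.
  - exact: mem_cells ux.
  move=> z cz; apply: contra uT => zT.
  apply: (mem_cells (x := z)); last exact: content_cells cz.
  by rewrite !inE zT andbT; apply/eqP => zx; apply: (xs u); rewrite cz zx.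
(* By minimality [T :\ y] is not tight, so it has a cell beyond [d.-1 * #|T :\ y|]; this leaves at
   most [d - 2] private cells to [y]. *)
have priv y : y \in T :\ x -> #|cells h [set y] :\: cells h (T :\ y)| <= d - 2.
  rewrite !inE => /andP[yx yT]; have cy := card_cellsD1 h yT.
  have cTy := cardsD1 y T; rewrite yT in cTy.
  have := Tmin (T :\ y); rewrite /tight !inE xT eq_sym yx /=.
  move: (sparse (T :\ y)) cy; rewrite cT cTy mulnDr muln1.
  move: #|T :\ y| #|_ :\: _| #|cells h _| (d.-1 * _) => c p a b ba eq.
  by case: eqP => [_ /(_ isT)|]; move: ba eq; clear; lia.
(* The count becomes [2(d-1)|T| <= d + (2d-2)(|T|-1)], that is [d <= 2]. *)
have := leq_sum_private h T; rewrite (bigD1 x) //= xpriv cards0 addn0.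
have : \sum_(y in T | y != x)
    (#|cells h [set y]| + #|cells h [set y] :\: cells h (T :\ y)|) <=
    (d + (d - 2)) * #|T :\ x|.
  rewrite mulnC -sum_nat_const.
  rewrite [leqRHS](eq_bigl (fun y => (y \in T) && (y != x))).
    apply: leq_sum => y /andP[yT yx].
    by rewrite leq_add ?card_cells1 ?priv ?inE ?yx.
  by move=> y; rewrite !inE andbC.
have := cardsD1 x T; rewrite xT cT => ->; rewrite mulnDr muln1.
move: cx d3; move: (\sum_(_ in _ | _) _) #|cells h [set x]| #|T :\ x| => s a c.
clear; case: d => [|[|[|e]]] // ae _; rewrite -mul2n /=; nia.
Qed.

(** * Termination *)

Lemma sum_wear d m n (h : hashing d m n) sigma t : execution h sigma ->
  (forall t', t' < t -> ~~ finished (sigma t')) ->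
  \sum_v wear (sigma t) v = t.
Proof.
move=> ex; have [s0 st] := ex; elim: t => [|t IHt] nf.
  by rewrite s0 big1 // => v _; rewrite ffunE.
have := st t; rewrite (negPf (nf t (ltnSn t))).
case/(stepP (consistent_execution t ex)) => x [v [b [-> _ _ _]]] /=.
under eq_bigr => u _ do rewrite ffunE.
rewrite big_split /= IHt => [|t' t't]; last by apply: nf; apply: ltnW.
rewrite (bigD1 v) //= eqxx big1 ?addn0 ?addn1 // => u /negPf -> //.
Qed.

Lemma finished_bounded_wear d m n (h : hashing d m n) sigma k :
  execution h sigma -> (forall t v, wear (sigma t) v <= k) ->
  exists t, finished (sigma t).
Proof.
move=> ex wk; have [/existsP[t ft]|] :=
  boolP [exists t : 'I_(m * k).+1, finished (sigma t)]; first by exists t.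
rewrite negb_exists => /forallP nf.
have := sum_wear (t := (m * k).+1) ex (fun t' lt => nf (Ordinal lt)).
have : \sum_v wear (sigma (m * k).+1) v <= \sum_(v : 'I_m) k.
  by apply: leq_sum => v _; apply: wk.
by rewrite sum_nat_const card_ord => le eq; rewrite eq ltnn in le.
Qed.

(** * First-moment bound *)

Lemma card_tuple_all (T : finType) d (V : {set T}) :
  #|[pred t : d.-tuple T | all (mem V) t]| = #|V| ^ d.
Proof.
pose f (t : d.-tuple T) := [ffun i => tnth t i].
have bf : bijective f.
  exists (fun g : {ffun 'I_d -> T} => [tuple g i | i < d]) => [t|g].
    by apply: eq_from_tnth => i; rewrite tnth_mktuple ffunE.
  by apply/ffunP => i; rewrite ffunE tnth_mktuple.
have := @card_ffun_on 'I_d T (mem V); rewrite card_ord => <-.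
rewrite -[RHS]cardsE -(on_card_preimset (onW_bij _ bf)) -cardsE.
apply: eq_card => t; rewrite !inE; apply/all_tnthP/ffun_onP => /= [tV i|fV i].
  by rewrite ffunE; apply: tV.
by have := fV i; rewrite ffunE.
Qed.

(** Independence of the items gives probability [(|V|/m)^(d|S|)]; the factor [(m ^ d) ^ #|S|] clears
    denominators so that the count stays in [nat]. *)
Lemma card_confined d m n (S : {set 'I_n}) (V : {set 'I_m}) :
  #|[set h : hashing d m n | cells h S \subset V]| * (m ^ d) ^ #|S| =
  (#|V| ^ d) ^ #|S| * (m ^ d) ^ n.
Proof.
pose F x := [pred t : d.-tuple 'I_m | (x \in S) ==> all (mem V) t].
have -> : #|[set h : hashing d m n | cells h S \subset V]| =
    #|(family F : simpl_pred (hashing d m n))|.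
  apply: eq_card => h; rewrite inE; apply/subsetP/familyP => hV x.
    rewrite inE; apply/implyP => xS; apply/allP => u ux.
    by apply: hV; apply: mem_cells xS ux.
  case/bigcupP => y yS; rewrite inE => xy.
  by have := hV y; rewrite inE yS => /allP/(_ _ xy).
rewrite card_family foldrE big_map big_enum /=.
rewrite (bigID (mem S)) /= (eq_bigr (fun=> #|V| ^ d)); last first.
  by move=> x xS; rewrite -card_tuple_all; apply: eq_card => t; rewrite !inE xS.
rewrite prod_nat_const (eq_bigr (fun=> m ^ d)); last first.
  move=> x /negPf xS; rewrite -[in RHS](card_ord m) -card_tuple.
  by apply: eq_card => t; rewrite !inE xS.
rewrite prod_nat_const -mulnA -expnD; congr (_ * _ ^ _).
by rewrite addnC -[RHS]card_ord -(cardC (mem S)).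
Qed.

(** Lets the union bound range over cell sets of size exactly [s], although [cells h S] may be
    smaller. *)
Lemma card_extend (T : finType) (W : {set T}) s :
  #|W| <= s <= #|T| -> exists2 V : {set T}, W \subset V & #|V| = s.
Proof.
move=> /andP[Ws sT].
exists (W :|: [set x in take (s - #|W|) (enum (~: W))]).
  exact: subsetUl.
rewrite card_disjointU; last first.
  rewrite disjoint_sym disjoints_subset; apply/subsetP => x; rewrite inE.
  by move=> /mem_take; rewrite mem_enum.
rewrite cardsE (card_uniqP (take_uniq _ (enum_uniq _))) size_takel ?subnKC //.
by rewrite -cardE; have := cardsC W; move: #|W| #|~: W| Ws sT; lia.
Qed.

Lemma leq_card_bigcup (I T : finType) (P : pred I) (F : I -> {set T}) :
  #|\bigcup_(i | P i) F i| <= \sum_(i | P i) #|F i|.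
Proof.
elim/big_rec2: _ => [|i k A _ le]; first by rewrite cards0.
by rewrite (leq_trans (leq_card_setU _ _)) // leq_add2l.
Qed.

Definition crowded d m n k s : {set hashing d m n} :=
  [set h : hashing d m n |
    [exists S : {set 'I_n}, (#|S| == k) && (#|cells h S| <= s)]].

Lemma card_crowded d m n k s : s <= m ->
  #|crowded d m n k s| * (m ^ d) ^ k <=
  'C(n, k) * 'C(m, s) * (s ^ d) ^ k * (m ^ d) ^ n.
Proof.
move=> sm.
pose P (p : {set 'I_n} * {set 'I_m}) := (#|p.1| == k) && (#|p.2| == s).
pose F (p : {set 'I_n} * {set 'I_m}) :=
  [set h : hashing d m n | cells h p.1 \subset p.2].
have sub : crowded d m n k s \subset \bigcup_(p | P p) F p.
  apply/subsetP => h; rewrite inE => /existsP[S /andP[/eqP Sk hs]].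
  have [|V SV Vs] := @card_extend _ (cells h S) s; first by rewrite hs card_ord.
  by apply/bigcupP; exists (S, V); rewrite /P ?Sk ?Vs ?eqxx // inE.
apply: (@leq_trans (\sum_(p | P p) #|F p| * (m ^ d) ^ k)).
  by rewrite -big_distrl leq_mul2r (leq_trans (subset_leq_card sub))
     ?leq_card_bigcup ?orbT.
rewrite (eq_bigr (fun=> (s ^ d) ^ k * (m ^ d) ^ n)); last first.
  by move=> [S V] /andP[/eqP /= Sk /eqP Vs]; rewrite -Sk card_confined Vs.
rewrite sum_nat_const -[leqRHS]mulnA leq_mul2r; apply/orP; right.
have -> : #|[pred p | P p]| = #|setX [set S : {set 'I_n} | #|S| == k]
                                     [set V : {set 'I_m} | #|V| == s]|.
  by apply: eq_card => -[S V]; rewrite !inE.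
by rewrite cardsX !card_draws !card_ord.
Qed.

(** The two bad events are [g S <= -1] for some nonempty [S], and [g S <= 1] for some [S] with at
    least [k0] items. Size 0 is left out of the first because the truncated predecessor would make
    the empty set crowded. *)
Definition exceptional d m n k0 : {set hashing d m n} :=
  (\bigcup_(k < n.+1 | 0 < k) crowded d m n k (d.-1 * k).-1) :|:
  (\bigcup_(k < n.+1 | k0 <= k) crowded d m n k (d.-1 * k).+1).

Lemma unexceptional d m n k0 (h : hashing d m n) :
  h \notin exceptional d m n k0 ->
  (forall S : {set 'I_n}, d.-1 * #|S| <= #|cells h S|) /\
  (forall S : {set 'I_n}, k0 <= #|S| -> (d.-1 * #|S|).+1 < #|cells h S|).
Proof.
rewrite in_setU negb_or => /andP[/bigcupP sparse /bigcupP conn].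
have Sn (S : {set 'I_n}) : #|S| < n.+1.
  by rewrite ltnS (leq_trans (max_card _)) ?card_ord.
split=> S; [rewrite leqNgt | move=> kS; rewrite ltnNge]; apply/negP => cS.
- apply: sparse; exists (Ordinal (Sn S)) => /=.
    by move: cS; case: #|S| => //; rewrite muln0.
  rewrite inE; apply/existsP; exists S; rewrite eqxx /=.
  by rewrite -ltnS (ltn_predK cS).
- apply: conn; exists (Ordinal (Sn S)) => //.
  by rewrite inE; apply/existsP; exists S; rewrite eqxx.
Qed.

From mathcomp Require Import boolp reals topology normedtype sequences exp.
From mathcomp Require Import ring lra.

Import Order.TTheory GRing.Theory Num.Theory.
Import numFieldNormedType.Exports.

Local Open Scope ring_scope.

(** * Estimates for the terms of the union bound *)

(** With [x = s/m], the left side is one term of the expansion of [(1 + x)^m], which is at most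
    [exp(x m)]. *)
Lemma bin_expn_le_expR (R : realType) (m s : nat) : (0 < m)%N ->
  'C(m, s)%:R * (s%:R / m%:R) ^+ s <= expR s%:R :> R.
Proof.
move=> m0; case: (leqP s m) => [sm|/bin_small ->]; last first.
  by rewrite mul0r expR_ge0.
set x : R := s%:R / m%:R.
have x0 : 0 <= x by rewrite divr_ge0 ?ler0n.
apply: (@le_trans _ _ ((1 + x) ^+ m)).
  rewrite exprDn (bigD1 (inord s)) //= inordK ?ltnS // expr1n mul1r mulr_natl.
  rewrite lerDl sumr_ge0 // => i _.
  by rewrite expr1n mul1r mulrn_wge0 ?exprn_ge0.
apply: (@le_trans _ _ (expR x ^+ m)).
  by rewrite lerXn2r ?expR_ge1Dx ?nnegrE ?expR_ge0 ?addr_ge0.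
by rewrite -expRM_natl mulrCA divff ?mulr1 // pnatr_eq0 -lt0n.
Qed.

(* ['C(C n, s)] absorbs [s] of the [d k] factors, leaving [e] of them. *)
Lemma crowded_term_le (R : realType) (d C n k s e : nat) :
  (0 < C)%N -> (0 < n)%N -> (s + e = d * k)%N ->
  'C(n, k)%:R * 'C(C * n, s)%:R * (s%:R / (C * n)%:R) ^+ (d * k) <=
  expR s%:R * ('C(n, k)%:R * ((d * k)%:R / (C * n)%:R) ^+ e) :> R.
Proof.
move=> C0 n0 dk; have m0 : (0 < C * n)%N by rewrite muln_gt0 C0.
rewrite -[in X in _ ^+ X]dk exprD.
set q : R := s%:R / _; set r : R := (d * k)%:R / _.
have q0 : 0 <= q by rewrite divr_ge0 ?ler0n.
have qr : q <= r by rewrite ler_pM2r ?invr_gt0 ?ltr0n // ler_nat -dk leq_addr.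
rewrite [leLHS](_ : _ = 'C(C * n, s)%:R * q ^+ s * ('C(n, k)%:R * q ^+ e));
  last by ring.
apply: ler_pM; rewrite ?mulr_ge0 ?ler0n ?exprn_ge0 ?bin_expn_le_expR //.
by rewrite ler_wpM2l ?ler0n // lerXn2r ?nnegrE // (le_trans q0).
Qed.

Lemma bin_ratio_le (R : realType) (d C n k : nat) : (0 < C)%N -> (0 < n)%N ->
  'C(n, k)%:R * ((d * k)%:R / (C * n)%:R) ^+ k <=
  expR k%:R * (d%:R / C%:R) ^+ k :> R.
Proof.
move=> C0 n0.
rewrite !natrM invfM mulrACA.
rewrite exprMn mulrCA [leRHS]mulrC.
by rewrite ler_wpM2l ?bin_expn_le_expR // exprn_ge0 // divr_ge0 ?ler0n.
Qed.

(** The choice of [C] makes each of the [k] factors [exp(d) d/C] at most 1/4. One half per factor is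
    kept for the geometric sum over [k]; the other pays for a factor [k] or [n ^ 2] later. *)
Lemma quarter_le (R : realType) (d C s k : nat) : (0 < C)%N ->
  4 * d%:R * expR d%:R <= C%:R :> R -> (s + k <= d * k)%N ->
  expR s%:R * (expR k%:R * (d%:R / C%:R) ^+ k) <= 2^-1 ^+ k * 2^-1 ^+ k :> R.
Proof.
move=> C0 Cd sk; rewrite mulrA -expRD -natrD.
apply: (@le_trans _ _ (expR (d * k)%:R * (d%:R / C%:R) ^+ k)).
  rewrite ler_wpM2r ?exprn_ge0 ?divr_ge0 ?ler0n // ler_expR ler_nat //.
rewrite natrM expRM_natr -!exprMn; apply: lerXn2r.
- by rewrite nnegrE mulr_ge0 ?expR_ge0 ?divr_ge0 ?ler0n.
- by rewrite nnegrE mulr_ge0 ?invr_ge0 ?ler0n.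
by rewrite mulrA ler_pdivrMr ?ltr0n //; lra.
Qed.

(** Here [s] is [(d-1)k - 1], so [k + 1] factors remain: [k] of them offset ['C(n, k)], and the last
    is at most [k/n], the source of the decay in [n]. *)
Lemma sparse_term_le (R : realType) (d C n k s : nat) :
  (0 < C)%N -> (d <= C)%N -> (0 < n)%N -> (s + k.+1 = d * k)%N ->
  4 * d%:R * expR d%:R <= C%:R :> R ->
  'C(n, k)%:R * 'C(C * n, s)%:R * (s%:R / (C * n)%:R) ^+ (d * k) <=
  2^-1 ^+ k / n%:R :> R.
Proof.
move=> C0 dC n0 dk Cd.
apply: le_trans (crowded_term_le _ C0 n0 dk) _.
set r : R := (d * k)%:R / _.
have r0 : 0 <= r by rewrite divr_ge0 ?ler0n.
rewrite exprSr [_%:R * (_ * r)]mulrA mulrA.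
apply: (@le_trans _ _ (2^-1 ^+ k * 2^-1 ^+ k * (k%:R / n%:R))).
  apply: ler_pM => //.
    by rewrite !mulr_ge0 ?expR_ge0 ?exprn_ge0 ?ler0n.
    apply: le_trans (quarter_le C0 Cd (s := s) _).
      by rewrite ler_wpM2l ?expR_ge0 ?bin_ratio_le.
    by rewrite -dk addnS leqnSn.
  rewrite ler_pdivrMr ?ltr0n ?muln_gt0 ?C0 // mulrAC -natrM.
  by rewrite ler_pdivlMr ?ltr0n // -natrM ler_nat; nia.
rewrite -mulrA ler_wpM2l ?exprn_ge0 ?invr_ge0 ?ler0n // mulrA.
rewrite ler_piMl ?invr_ge0 ?ler0n // exprVn mulrC.
rewrite ler_pdivrMr ?exprn_gt0 ?ltr0n //.
by rewrite mul1r -(natrX _ 2 k) ler_nat; apply: ltnW; apply: ltn_expl.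
Qed.

(** Here [s] is [(d-1)k + 1], so one factor is missing, at a cost of at most [C * n]. The hypothesis
    [n ^ 2 <= 2 ^ k] turns the spare [2^-k] into enough to leave [1/n]. *)
Lemma connected_term_le (R : realType) (d C n k s : nat) :
  (0 < d)%N -> (0 < C)%N -> (0 < n)%N -> (0 < k)%N -> (n ^ 2 <= 2 ^ k)%N ->
  (s + k = (d * k).+1)%N -> 4 * d%:R * expR d%:R <= C%:R :> R ->
  'C(n, k)%:R * 'C(C * n, s)%:R * (s%:R / (C * n)%:R) ^+ (d * k) <=
  expR 1 * C%:R * (2^-1 ^+ k / n%:R) :> R.
Proof.
move=> d0 C0 n0 k0 nk sk Cd; have dk : (s + k.-1 = d * k)%N by lia.
apply: le_trans (crowded_term_le _ C0 n0 dk) _.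
set r : R := (d * k)%:R / _.
have r0 : 0 < r by rewrite divr_gt0 ?ltr0n ?muln_gt0 ?C0 ?d0.
have -> : r ^+ k.-1 = r ^+ k * r^-1.
  by rewrite -{2}(prednK k0) exprSr mulfK ?gt_eqF.
have rV : r^-1 <= (C * n)%:R.
  rewrite invf_div ler_pdivrMr ?ltr0n ?muln_gt0 ?d0 //.
  by rewrite ler_peMr ?ler0n // ler1n muln_gt0 d0.
have s0 : (0 < s)%N by nia.
rewrite -(prednK s0) -addn1 natrD expRD [expR _ * expR 1]mulrC -!mulrA.
rewrite ler_wpM2l ?expR_ge0 // [_%:R * (_ * r^-1)]mulrA mulrA.
apply: (@le_trans _ _ (2^-1 ^+ k * 2^-1 ^+ k * (C * n)%:R)).
  apply: ler_pM; rewrite ?invr_ge0 ?(ltW r0) //.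
    by rewrite !mulr_ge0 ?expR_ge0 ?exprn_ge0 ?(ltW r0) ?ler0n.
  apply: le_trans (quarter_le C0 Cd (s := s.-1) _); last by lia.
  by rewrite ler_wpM2l ?expR_ge0 ?bin_ratio_le.
rewrite natrM mulrCA -!mulrA ler_wpM2l ?ler0n //.
rewrite ler_wpM2l ?exprn_ge0 ?invr_ge0 ?ler0n //.
rewrite -[leRHS]mul1r ler_pdivlMr ?ltr0n // -mulrA exprVn mulrC.
rewrite ler_pdivrMr ?exprn_gt0 ?ltr0n //.
by rewrite mul1r -natrM -(natrX _ 2 k) ler_nat mulnn.
Qed.

(** * Probability of the exceptional hashings *)

Lemma proba_crowded_le (R : realType) d m n k s : (0 < m)%N -> (s <= m)%N ->
  #|crowded d m n k s|%:R / #|{: hashing d m n}|%:R <=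
  'C(n, k)%:R * 'C(m, s)%:R * (s%:R / m%:R) ^+ (d * k) :> R.
Proof.
move=> m0 sm; rewrite card_ffun card_tuple !card_ord.
rewrite ler_pdivrMr ?ltr0n ?expn_gt0 ?m0 // expr_div_n mulrA mulrAC.
rewrite ler_pdivlMr ?exprn_gt0 ?ltr0n // -!natrX -!natrM ler_nat.
by rewrite !(expnM _ d k) card_crowded.
Qed.

Lemma sum_half_le (R : realType) N : \sum_(k < N) 2^-1 ^+ k <= 2 :> R.
Proof.
have -> : \sum_(k < N) 2^-1 ^+ k = 2 - 2 * 2^-1 ^+ N :> R.
  elim: N => [|N IHN]; first by rewrite big_ord0 expr0 mulr1 subrr.
  by rewrite big_ord_recr /= IHN exprS; lra.
by rewrite gerBl mulr_ge0 ?exprn_ge0 ?invr_ge0.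
Qed.

Lemma proba_exceptional_le (R : realType) d C n k0 :
  (2 < d)%N -> (d <= C)%N -> (0 < n)%N -> (0 < k0)%N -> (n ^ 2 <= 2 ^ k0)%N ->
  4 * d%:R * expR d%:R <= C%:R :> R ->
  #|exceptional d (C * n) n k0|%:R / #|{: hashing d (C * n) n}|%:R <=
  2 * (1 + expR 1 * C%:R) / n%:R :> R.
Proof.
move=> d3 dC n0 k00 nk Cd; set N : R := #|{: _}|%:R.
have d0 : (0 < d)%N by apply: ltn_trans d3.
have C0 : (0 < C)%N by apply: leq_trans dC.
have m0 : (0 < C * n)%N by rewrite muln_gt0 C0.
have N0 : 0 <= N^-1 by rewrite invr_ge0 ler0n.
have half (P : pred 'I_n.+1) :
    \sum_(k < n.+1 | P k) 2^-1 ^+ k / n%:R <= 2 / n%:R :> R.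
  rewrite -mulr_suml ler_wpM2r ?invr_ge0 ?ler0n //.
  apply: le_trans (sum_half_le R n.+1); rewrite [leRHS](bigID P) /=.
  by rewrite lerDl sumr_ge0 // => k _; rewrite exprn_ge0 // invr_ge0.
(* Bounds the number [s] of cells by the table size, as the union bound requires. *)
have sm k : (k < n.+1)%N -> (d * k <= C * n)%N by move=> kn; apply: leq_mul.
apply: (@le_trans _ _ (\sum_(k < n.+1 | (0 < k)%N) 2^-1 ^+ k / n%:R +
    expR 1 * C%:R * \sum_(k < n.+1 | (k0 <= k)%N) 2^-1 ^+ k / n%:R)); last first.
  have := half (fun k => 0 < k)%N; have := half (fun k => k0 <= k)%N.
  move=> /(ler_wpM2l (_ : 0 <= expR 1 * C%:R)) le2 le1.
  apply: le_trans (lerD le1 (le2 _)) _; last by lra.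
  by rewrite mulr_ge0 ?expR_ge0.
apply: (@le_trans _ _ ((\sum_(k < n.+1 | (0 < k)%N)
      #|crowded d (C * n) n k (d.-1 * k).-1|%:R +
    \sum_(k < n.+1 | (k0 <= k)%N) #|crowded d (C * n) n k (d.-1 * k).+1|%:R) / N)).
  rewrite ler_wpM2r // -!natr_sum -natrD ler_nat.
  by rewrite (leq_trans (leq_card_setU _ _)) // leq_add ?leq_card_bigcup.
rewrite mulrDl !mulr_suml mulr_sumr.
apply: lerD; apply: ler_sum => k kP.
- have kn := sm k (ltn_ord k).
  have sk : ((d.-1 * k).-1 + k.+1 = d * k)%N.
    by move: (nat_of_ord k) kP d3; clear; case: d => // d' k k0 d3; nia.
  apply: le_trans (sparse_term_le C0 dC n0 sk Cd).
  apply: proba_crowded_le => //.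
  by rewrite (leq_trans _ kn) // -sk leq_addr.
- have kn := sm k (ltn_ord k).
  have k1 : (0 < k)%N by apply: leq_trans kP.
  have sk : ((d.-1 * k).+1 + k = (d * k).+1)%N.
    by move: d3; clear; case: d => // d' _; rewrite /= mulSn; lia.
  have nk' : (n ^ 2 <= 2 ^ k)%N by rewrite (leq_trans nk) // leq_exp2l.
  apply: le_trans (connected_term_le d0 C0 n0 k1 nk' sk Cd).
  apply: proba_crowded_le => //.
  by rewrite (leq_trans _ kn) // -ltnS -sk -addn1 leq_add2l.
Qed.

(** * Iterated logarithms and the limit *)

Lemma uniform_proba_le1 (R : realType) (Omega : finType) (E : Omega -> Prop) :
  uniform_proba R E <= 1.
Proof.
rewrite /uniform_proba; have [->|O0] := posnP #|Omega|.
  by rewrite invr0 mulr0.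
by rewrite ler_pdivrMr ?ltr0n // mul1r ler_nat max_card.
Qed.

Lemma uniform_proba_ge (R : realType) (Omega : finType) (E : Omega -> Prop)
    (B : {set Omega}) : (0 < #|Omega|)%N -> (forall w, w \notin B -> E w) ->
  1 - #|B|%:R / #|Omega|%:R <= uniform_proba R E.
Proof.
move=> O0 BE.
rewrite lerBlDr -mulrDl ler_pdivlMr ?ltr0n // mul1r -natrD ler_nat.
rewrite addnC -(cardsC B) leq_add2l subset_leq_card //.
by apply/subsetP => w; rewrite !inE => /BE /asboolP.
Qed.

Lemma up_log_le_log2 (R : realType) n : (1 < n)%N ->
  (up_log 2 n)%:R <= log2 (n%:R : R) + 1.
Proof.
move=> n1; have ln2 : 0 < ln 2 :> R by rewrite ln_gt0 ?ltr1n.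
rewrite -lerBlDr ler_pdivlMr //.
have u0 : (0 < up_log 2 n)%N by rewrite up_log_gt0.
rewrite -(prednK u0) -natr1 addrK mulr_natl -lnXn ?ltr0n //.
rewrite ler_ln ?posrE ?exprn_gt0 ?ltr0n ?(ltnW n1) // -natrX ler_nat.
by rewrite ltnW ?up_log_gtn.
Qed.

(** With [L = log2 n >= 1], the inner number is at most [2(L + 1) + 1 <= 8L]. The factor 8
    contributes 3 to the logarithm, and rounding up contributes 1. *)
Lemma up_log_up_log_le (R : realType) n : (1 < n)%N ->
  (up_log 2 (2 * up_log 2 n).+1)%:R <= log2 (log2 (n%:R : R)) + 4.
Proof.
move=> n1; have ln2 : 0 < ln 2 :> R by rewrite ln_gt0 ?ltr1n.
have u0 : (0 < up_log 2 n)%N by rewrite up_log_gt0.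
have L1 : 1 <= log2 (n%:R : R).
  by rewrite ler_pdivlMr // mul1r ler_ln ?posrE ?ltr0n ?(ltnW n1) // ler_nat.
have L0 : 0 < log2 (n%:R : R) by apply: lt_le_trans L1.
apply: le_trans (up_log_le_log2 R _) _; first by rewrite ltnS muln_gt0.
suff : log2 ((2 * up_log 2 n).+1%:R : R) <= log2 (log2 (n%:R : R)) + 3 by lra.
have -> : log2 (log2 (n%:R : R)) + 3 = log2 (2 ^+ 3 * log2 (n%:R : R)).
  rewrite [in RHS]/log2 lnM ?posrE ?exprn_gt0 // lnXn // mulrDl.
  by rewrite -[ln 2 *+ 3]mulr_natl mulfK ?gt_eqF // addrC.
rewrite ler_pM2r ?invr_gt0 // ler_ln ?posrE ?ltr0n //; last first.
  by apply: mulr_gt0 => //; rewrite exprn_gt0.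
by rewrite -natr1 natrM; have := up_log_le_log2 R n1; lra.
Qed.

Lemma max_wear_unexceptional (R : realType) d m n (h : hashing d m n) :
  (2 < d)%N -> (1 < n)%N -> h \notin exceptional d m n (2 * up_log 2 n).+1 ->
  max_wear_le h (log2 (log2 (n%:R : R)) + 4).
Proof.
move=> d3 n1 /unexceptional[sparse big] sigma ex.
(* The level is the least [k] with [k0 <= 2 ^ k], for [k0 = 2 * up_log 2 n + 1], a size large enough
   that [n ^ 2 <= 2 ^ k0]. *)
have wk t v := wear_bound t v d3 ex sparse big (up_logP _ (isT : 1 < 2)%N).
have [T fT] := finished_bounded_wear ex wk.
exists T; split => // v; apply: le_trans (up_log_up_log_le R n1).
by rewrite ler_nat.
Qed.

From mathcomp Require Import classical_sets.

Local Open Scope classical_set_scope.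
Local Open Scope ring_scope.

Theorem theorem1 (R : realType) (d : nat) (hd : (3 <= d)%N) :
  exists C : nat, (0 < C)%N /\
  exists c : R,
    (fun n : nat =>
       uniform_proba R (fun h : hashing d (C * n)%N n =>
         max_wear_le h (log2 (log2 (n%:R : R)) + c))) @ \oo --> (1 : R).
Proof.
set r : R := 4 * d%:R * expR d%:R.
have r0 : 0 <= r by rewrite !mulr_ge0 ?expR_ge0.
(* The first summand exceeds [4 d exp(d)]; the second ensures [d <= C]. *)
pose C := (Num.bound r + d)%N.
have Cd : r <= C%:R.
  by rewrite (le_trans (ltW (archi_boundP r0))) // ler_nat leq_addr.
have dC : (d <= C)%N by rewrite leq_addl.
have C0 : (0 < C)%N by apply: leq_trans dC; apply: leq_trans hd.
exists C; split => //; exists 4.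
pose D : R := 2 * (1 + expR 1 * C%:R).
have D0 : 0 <= D by rewrite mulr_ge0 ?addr_ge0 ?mulr_ge0 ?expR_ge0.
(* The failure probability is at most [D/n], and [harmonic n] is [1/(n+1)]; the factor 2 absorbs
   this shift. *)
apply: (squeeze_cvgr (f := fun n => 1 - 2 * D * harmonic n) (h := fun=> 1)).

- near=> n; rewrite uniform_proba_le1 andbT.
  have n1 : (1 < n)%N by near: n; exact: nbhs_infty_ge.
  have n0 : (0 < n)%N by apply: ltnW.
  apply: (@le_trans _ _ (1 - #|exceptional d (C * n) n (2 * up_log 2 n).+1|%:R /
      #|{: hashing d (C * n) n}|%:R)).
    rewrite lerD2l lerN2.
    apply: le_trans (proba_exceptional_le hd dC n0 _ _ Cd) _ => //.
      apply: (@leq_trans ((2 ^ up_log 2 n) ^ 2)).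
        by rewrite leq_exp2r ?up_logP.
      by rewrite -expnM leq_exp2l // mulnC.
    rewrite -/D [2 * D]mulrC -[D * 2 * _]mulrA ler_wpM2l //=.
    rewrite ler_pdivlMr ?ltr0n // mulrC.
    by rewrite ler_pdivrMr ?ltr0n // -natrM ler_nat; lia.
  apply: uniform_proba_ge => [|h]; last exact: max_wear_unexceptional.
  by rewrite card_ffun card_tuple !card_ord !expn_gt0 muln_gt0 C0 n0.
- rewrite -[X in _ --> X]subr0 -[X in _ - X](mulr0 (2 * D)).
  by apply: cvgB; [exact: cvg_cst|apply: cvgMl_tmp; exact: cvg_harmonic].
- exact: cvg_cst.
Unshelve. all: by end_near.
Qed.
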